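(* Let $n\ge 1$, let $\mathcal{T}_n$ be an $n$-periodic triangulation of the strip $\mathcal{U}_n$ with associated $n$-arithmetic frieze $\mathcal{F}_{\mathcal{T}_n}=(m_{ij})_{j-i\ge -2}$. Then for all $i\le j$ (and any $k\in\mathbb{Z}$) $$m_{ij}=\left|\mathcal{M}_{i^{(k)}j^{(k)}}\right|.$$
   Context: Infinite friezes: an infinite frieze is an array $(m_{ij})_{i,j\in\mathbb{Z},\,j-i\ge -2}$ of integers with $m_{i,i-2}=0$, $m_{i,i-1}=1$ for all $i$, $m_{ij}>0$ for all $j\ge i$, and $m_{ij}m_{i+1,j+1}-m_{i+1,j}m_{i,j+1}=1$ for all $j-i\ge -1$. It is $n$-periodic if $m_{ij}=m_{i+n,j+n}$ for all $i\le j$; its quiddity sequence is then $(m_{11},\dots,m_{nn})$, which determines it. Strip: $\mathcal{U}_n$ is $\mathbb{R}\times$ (closed interval) with vertices $0^{(k)}$, $k\in\mathbb{Z}$, on the upper boundary and vertices $1^{(k)},\dots,n^{(k)}$, $k\in\mathbb{Z}$, on the lower boundary, ordered from left to right on the lower boundary by: $i^{(k)}\le j^{(l)}$ iff $k<l$, or $k=l$ and $i\le j$; the vertices $0^{(k)}$ are ordered from left to right by $k$, with $0^{(k)}$ above $1^{(k)},\dots,n^{(k)}$. Convention: $(i+ln)^{(k)}=i^{(k+l)}$ for $1\le i\le n$, $l\in\mathbb{Z}$, so $i^{(k)}$ makes sense for every $i\in\mathbb{Z}$ as a lower vertex. An arc in $\mathcal{U}_n$ is (the isotopy class of) a non-self-intersecting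 curve connecting two vertices such that (A1) at least one vertex is on the lower boundary; (A2) the two vertices are neither equal nor neighbors; (A3) if one vertex is on the upper boundary, the superscripts of the two vertices are equal (so the arcs to the upper boundary are $0^{(k)}j^{(k)}$, $1\le j\le n$). A triangulation of $\mathcal{U}_n$ is a maximal collection of arcs that pairwise do not meet in the interior of $\mathcal{U}_n$; the regions into which it cuts $\mathcal{U}_n$ are called triangles. It is $n$-periodic if it has a fundamental domain: an $(n+3)$-gon $\mathcal{P}$ with vertices $0^{(k)},0^{(k+1)}$ and $i^{(k)},(i+1)^{(k)},\dots,n^{(k)},1^{(k+1)},\dots,i^{(k+1)}$ for some $i\in\{1,\dots,n\}$, $k\in\mathbb{Z}$, bounded on the sides by the arcs $0^{(k)}i^{(k)}$ and $0^{(k+1)}i^{(k+1)}$ of the triangulation, such that the triangulation is covered by the horizontal translates of $\mathcal{P}$ (shifting superscripts by integers). In an $n$-periodic triangulation each triangle is either bounded by three sides, or is a four-sided region having one side a segment $0^{(k)}0^{(k+1)}$ of the upper boundary (such a region also counts as a triangle). Associated frieze: the quiddity sequence of an $n$-periodic triangulation $\mathcal{T}_n$ is $(a_1,\dots,a_n)$, where $a_i$ is the number of triangles of $\mathcal{T}_n$ incident with $i^{(k)}$ (independent of $k$). $\mathcal{F}_{\mathcal{T}_n}$ is the $n$-periodic infinite frieze with $m_{ii}=a_i$ for $1\le i\le n$ (it exists and is $n$-arithmetic, meaning that for all $i\in\mathbb{Z}$ and $k\in\{1,\dots,n\}$ the difference $m_{i,(i+k-3)+(l+1)n}-m_{i,(i+k-3)+ln}$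 is the same for all $l\ge0$). Matchings: for a set $I$ of $s\ge1$ consecutive vertices $v_1,v_2,\dots,v_s$ (from left to right) on the lower boundary of $\mathcal{U}_n$, a matching between $I$ and $\mathcal{T}_n$ is an $s$-tuple $(\tau_1,\dots,\tau_s)$ of pairwise distinct triangles of $\mathcal{T}_n$ such that $\tau_t$ is incident with $v_t$ for each $t$. $\mathcal{M}_{v_1v_s}=\mathcal{M}_{v_1v_s}(\mathcal{T}_n)$ is the set of all such matchings. *)

(* Defs.v *)
From HB Require Import structures.
From mathcomp Require Import all_boot all_order all_algebra.
From mathcomp Require Import boolp classical_sets functions cardinality.

Set Implicit Arguments.
Unset Strict Implicit.
Unset Printing Implicit Defensive.

Import Order.TTheory GRing.Theory Num.Theory.
Local Open Scope classical_set_scope.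
Local Open Scope ring_scope.

Definition has_card (X : Type) (A : set X) (z : int) : Prop :=
  exists2 c : nat, (A #= `I_c)%card & z = c%:Z.

(* Only the values [m i j] with [j - i >= -2] are meaningful. *)
Definition infinite_frieze (m : int -> int -> int) : Prop :=
  [/\ forall i, m i (i - 2) = 0,
      forall i, m i (i - 1) = 1,
      forall i j, i <= j -> 0 < m i j &
      forall i j, -1 <= j - i ->
        m i j * m (i + 1) (j + 1) - m (i + 1) j * m i (j + 1) = 1].

Definition periodic_frieze (n : nat) (m : int -> int -> int) : Prop :=
  forall i j, i <= j -> m i j = m (i + n%:Z) (j + n%:Z).

(* Vertices of the strip: [inl k] is the upper vertex 0^(k); [inr p] is the
   p-th lower vertex from left to right, where i^(k) has position i + k n.  For
   i outside 1..n this is the convention (i + l n)^(k) = i^(k + l). *)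
Definition vertex := (int + int)%type.

Definition upper (k : int) : vertex := inl k.

Definition position (n : nat) (i k : int) : int := i + k * n%:Z.

Definition lower (n : nat) (i k : int) : vertex := inr (position n i k).

Definition neighbors (u v : vertex) : bool :=
  match u, v with
  | inl k, inl l => `|k - l| == 1
  | inr p, inr q => `|p - q| == 1
  | _, _ => false
  end.

(* The lower vertex at position p is i^(k) for some i in 1..n. *)
Definition superscript (n : nat) (p k : int) : bool :=
  position n 1 k <= p <= position n n%:Z k.

(* The strip is simply connected, so an isotopy class of curves is determined
   by its two ends.  An arc is recorded once, as a pair: the upper end comes
   first if there is one, and otherwise the left end. *)
Definition is_arc (n : nat) (a : vertex * vertex) : bool :=
  match a with
  | (inl k, inr p) => superscript n p k
  | (inr p, inr q) => (p < q) && ~~ neighbors (inr p) (inr q)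
  | _ => false
  end.

(* Two arcs can be drawn without meeting in the interior unless their ends
   strictly alternate along the boundary. *)
Definition crossing (a b : vertex * vertex) : bool :=
  match a, b with
  | (inr p, inr q), (inr r, inr s) => (p < r < q) && (q < s)
                                      || (r < p < s) && (s < q)
  | (inl _, inr p), (inr r, inr s) => r < p < s
  | (inr p, inr q), (inl _, inr r) => p < r < q
  | (inl k, inr p), (inl l, inr q) => (k < l) && (q < p) || (l < k) && (p < q)
  | _, _ => false
  end.

Definition noncrossing_arcs (n : nat) (T : set (vertex * vertex)) : Prop :=
  (forall a, T a -> is_arc n a) /\
  (forall a b, T a -> T b -> ~~ crossing a b).

Definition triangulation (n : nat) (T : set (vertex * vertex)) : Prop :=
  noncrossing_arcs n T /\
  (forall T', noncrossing_arcs n T' -> T `<=` T' -> T' = T).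

Definition shift_vertex (n : nat) (l : int) (v : vertex) : vertex :=
  match v with
  | inl k => inl (k + l)
  | inr p => inr (p + l * n%:Z)
  end.

Definition shift_arc (n : nat) (l : int) (a : vertex * vertex) :
    vertex * vertex :=
  (shift_vertex n l a.1, shift_vertex n l a.2).

(* The (n+3)-gon with vertices 0^(k), 0^(k+1), i^(k), ..., i^(k+1). *)
Definition domain_vertex (n : nat) (i k : int) (v : vertex) : bool :=
  match v with
  | inl l => (l == k) || (l == k + 1)
  | inr p => position n i k <= p <= position n i (k + 1)
  end.

Definition fundamental_domain (n : nat) (T : set (vertex * vertex))
    (i k : int) : Prop :=
  [/\ T (upper k, lower n i k),
      T (upper (k + 1), lower n i (k + 1)) &
      forall a, T a <-> exists l b,
        [/\ T b, domain_vertex n i k b.1, domain_vertex n i k b.2 &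
            a = shift_arc n l b]].

Definition periodic_triangulation (n : nat) (T : set (vertex * vertex)) :
    Prop :=
  triangulation n T /\
  exists i k, 1 <= i <= n%:Z /\ fundamental_domain n T i k.

Definition joined (T : set (vertex * vertex)) (u v : vertex) : Prop :=
  T (u, v) \/ T (v, u).

(* A region is given by its upper and its lower vertices, each listed from left
   to right; [contour] goes once around it. *)
Definition region := (seq int * seq int)%type.

Definition contour (r : region) : seq vertex :=
  map inr r.2 ++ map inl (rev r.1).

Definition incident (r : region) (v : vertex) : bool := v \in contour r.

(* The regions cut out by T: polygons whose sides are arcs of T or boundary
   segments, and which no arc of T cuts further.  Regions with infinitely many
   vertices do not occur when T is periodic. *)
Definition triangle (T : set (vertex * vertex)) (r : region) : Prop :=
  let c := contour r in
  [/\ sorted <%R r.1, sorted <%R r.2, (2 < size c)%N,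
      forall v, v \in c -> neighbors v (next c v) \/ joined T v (next c v) &
      forall u v, u \in c -> v \in c -> joined T u v ->
        v = next c u \/ u = next c v].

(* By periodicity the number of triangles at i^(k) does not depend on k. *)
Definition quiddity (n : nat) (T : set (vertex * vertex)) (i a : int) : Prop :=
  has_card [set r | triangle T r /\ incident r (lower n i 0)] a.

Definition associated_frieze (n : nat) (T : set (vertex * vertex))
    (m : int -> int -> int) : Prop :=
  [/\ infinite_frieze m, periodic_frieze n m &
      forall i, 1 <= i <= n%:Z -> quiddity n T i (m i i)].

(* Matchings between T and the lower vertices at positions p, ..., q; meant for
   p <= q. *)
Definition matchings (T : set (vertex * vertex)) (p q : int) :
    set (`|q - p|%N.+1.-tuple region) :=
  [set tau : `|q - p|%N.+1.-tuple region | [/\ uniq tau,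
      forall t, triangle T (tnth tau t) &
      forall t, incident (tnth tau t) (inr (p + (nat_of_ord t)%:Z))]].

Arguments matchings T p q : clear implicits.

(* Main.v *)
(* A lower vertex x joined to the upper boundary owns the triangle to its right
   having an upper vertex; any other lower vertex lies strictly below some arc
   and owns the triangle in which it is the middle vertex.  This is a bijection
   between lower vertices and triangles.  Matching every vertex strictly below a
   given arc with its own triangle is the only matching of these vertices.

   Let M(p,q) be the number of matchings of the vertices p, ..., q.  Choosing a
   triangle at y = q+1 for a given matching of p, ..., q fails exactly when the
   triangle is already used by some t <= q, which forces t to be joined to y and
   the vertices between t and y to have their own triangles.  Summing over the
   neighbours t of y, which form a chain y-1 > L(y-1) > L(L(y-1)) > ... of left
   ends of triangles with right end y, the numbers of such collisions telescope
   to M(p,q-1).  So M(p,q+1) = a_y M(p,q) - M(p,q-1), and the unimodular rule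
   gives the same recurrence for the frieze. *)
Require Import Defs.
From mathcomp Require Import all_boot all_order all_algebra.
From mathcomp Require Import boolp classical_sets functions cardinality.
From mathcomp Require Import zify ring.

Set Implicit Arguments.
Unset Strict Implicit.

Import Order.TTheory GRing.Theory Num.Theory.
Local Open Scope classical_set_scope.
Local Open Scope ring_scope.

(** * Lists of matchings *)

Lemma count_bij (T1 T2 : eqType) (l1 : seq T1) (l2 : seq T2) (P : pred T1)
    (Q : pred T2) (phi : T1 -> T2) (psi : T2 -> T1) :
  uniq l1 -> uniq l2 ->
  (forall x, x \in l1 -> P x -> [/\ phi x \in l2, Q (phi x) & psi (phi x) = x]) ->
  (forall y, y \in l2 -> Q y -> [/\ psi y \in l1, P (psi y) & phi (psi y) = y]) ->
  count P l1 = count Q l2.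
Proof.
move=> u1 u2 h1 h2; rewrite -!size_filter -(size_map phi).
apply/perm_size/uniq_perm; last 1 first.
- move=> y; apply/mapP/idP => [[x]|].
    by rewrite !mem_filter => /andP[Px xl] ->; case: (h1 x xl Px) => -> ->.
  rewrite mem_filter => /andP[Qy yl]; case: (h2 y yl Qy) => a b c.
  by exists (psi y) => //; rewrite mem_filter b.
- rewrite map_inj_in_uniq ?filter_uniq // => x y.
  rewrite !mem_filter => /andP[Px xl] /andP[Py yl] e.
  by case: (h1 x xl Px) => _ _ <-; rewrite e; case: (h1 y yl Py).
- exact: filter_uniq.
Qed.

Section Matchings.
Variables (I : int -> seq int).
Hypothesis I_uniq : forall x, uniq (I x).

(** Triangles are represented by the lower vertices that own them: entry [t] of a list is the owner
    of the triangle chosen at [p + t]. The length [s] counts vertices, so [s = 0] gives the single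
    empty matching. *)
Fixpoint matching_seqs (p : int) (s : nat) : seq (seq int) :=
  if s is t.+1 then
    [seq rcons f w | f <- matching_seqs p t,
                     w <- [seq w <- I (p + t%:Z) | w \notin f]]
  else [:: [::]].

Lemma mem_matching_seqs (p : int) s (f : seq int) :
  reflect [/\ size f = s, uniq f &
              forall t, (t < s)%N -> nth 0 f t \in I (p + t%:Z)]
          (f \in matching_seqs p s).
Proof.
elim: s f => [|s IHs] f /=.
  by rewrite inE; apply: (iffP eqP) => [->|[/size0nil ->]].
apply: (iffP allpairsPdep) => [[g [w [/IHs[sg ug hg]]]]|].
  rewrite mem_filter => /andP[wg wI] ->; split.
  - by rewrite size_rcons sg.
  - by rewrite rcons_uniq wg.
  - move=> t; rewrite ltnS leq_eqVlt => /orP[/eqP->|ts].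
      by rewrite nth_rcons sg ltnn eqxx.
    by rewrite nth_rcons sg ts hg.
case/lastP: f => [[]//|g w] [].
rewrite size_rcons rcons_uniq => -[sg] /andP[wg ug] h.
exists g, w; split => //.
  apply/IHs; split => // t ts.
  by move: (h t (ltnW ts)); rewrite nth_rcons sg ts.
by rewrite mem_filter wg /=; move: (h s (ltnSn s)); rewrite nth_rcons sg ltnn eqxx.
Qed.

Lemma matching_seqs_uniq (p : int) s : uniq (matching_seqs p s).
Proof.
elim: s => [//|s IHs] /=; apply: allpairs_uniq_dep => //.
  by move=> f _; apply: filter_uniq.
by move=> [f w] [g v] _ _ /= /rcons_inj[-> ->].
Qed.

Lemma count_mem_nth (f J : seq int) :
  uniq f -> uniq J ->
  count (mem f) J = (\sum_(0 <= t < size f) (nth 0%R f t \in J))%N.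
Proof.
move=> uf uJ; transitivity (count (mem J) f).
  by apply: (@count_bij _ _ J f _ _ id id).
rewrite -sum1_count big_mkcond (big_nth 0%R).
by apply: eq_bigr => t _ /=; case: (_ \in J).
Qed.

(** For each matching [f] of [s] vertices, a triangle at the next vertex is either new, and extends
    [f], or already occurs in [f]. The sum sorts these collisions by the position [t] at which they
    occur. *)
Lemma size_matching_seqsS (p : int) s :
  (size (matching_seqs p s.+1) +
   \sum_(0 <= t < s)
      count (fun f => nth 0%R f t \in I (p + s%:Z)) (matching_seqs p s)
   = size (I (p + s%:Z)) * size (matching_seqs p s))%N.
Proof.
rewrite /= size_allpairs_dep sumnE big_map.
have -> : (\sum_(0 <= t < s)
    count (fun f => nth 0%R f t \in I (p + s%:Z)%R) (matching_seqs p s) =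
  \sum_(f <- matching_seqs p s) count (mem f) (I (p + s%:Z)%R))%N.
  under eq_bigr do rewrite -sum1_count big_mkcond /=.
  rewrite exchange_big /= big_seq [RHS]big_seq; apply: eq_bigr => f.
  case/mem_matching_seqs => sf uf _; rewrite count_mem_nth // sf.
  by apply: eq_bigr => t _; case: ifP.
rewrite -big_split /= (eq_bigr (fun=> size (I (p + s%:Z)%R))).
  by rewrite big_const_seq count_predT iter_addn_0 mulnC.
move=> f _; rewrite size_filter addnC.
by rewrite -(count_predC (mem f) (I (p + s%:Z)%R)).
Qed.

End Matchings.

(** * The recurrence for the number of matchings *)

Section FanSystem.
(** A combinatorial model of the triangulation: [E] stands for arcs and boundary segments between
    lower vertices, [sp] for the lower vertices joined to the upper boundary. *)
Variables (E : rel int) (sp : pred int) (L R : int -> int).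
Hypothesis E_lt : forall u v, E u v -> u < v.
Hypothesis E_succ : forall u, E u (u + 1).
Hypothesis E_nc : forall u v r s, E u v -> E r s -> ~~ ((u < r < v) && (v < s)).
Hypothesis E_sp : forall u v x, E u v -> sp x -> ~~ (u < x < v).
Hypothesis nonspoke_sides :
  forall x, ~~ sp x -> [/\ E (L x) x, E x (R x) & E (L x) (R x)].
Hypothesis spoke_side : forall x, sp x -> E x (R x) /\ sp (R x).

(** Incidence of the vertex [x] with the triangle owned by [w]. *)
Definition inc (x w : int) : bool :=
  [|| x == w, x == R w | ~~ sp w && (x == L w)].

Variant fan_spec (x : int) : bool -> Type :=
| FanSpoke of E x (R x) & sp (R x) & x < R x : fan_spec x true
| FanNonspoke of E (L x) x & E x (R x) & E (L x) (R x) & L x < x & x < R x :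
    fan_spec x false.

Lemma fanP (x : int) : fan_spec x (sp x).
Proof.
case: (boolP (sp x)) => [/spoke_side[a b]|/nonspoke_sides[a b c]].
  by constructor => //; apply: E_lt.
by constructor => //; apply: E_lt.
Qed.

(** If [L x] or [R x] lay beyond the ends of the edge, a side of the triangle of [x] would cross
    it. *)
Lemma enclosing (x r s : int) : E r s -> r < x < s -> [/\ ~~ sp x, r <= L x & R x <= s].
Proof.
move=> Ers h; have := @E_sp _ _ x Ers.
case: (fanP x) => [_ _ _ /(_ isT)|Elx Exr Elr lx xr _]; first by rewrite h.
move: (E_nc Elx Ers) (E_nc Ers Exr) => n1 n2; split => //; lia.
Qed.

Lemma inc_inside (u v w x : int) : E u v -> u < w < v -> inc x w -> u <= x <= v.
Proof.
move=> Euv h; case: (enclosing Euv h) => nw a b.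
case: (fanP w) nw => // _ _ _ lw wr _.
by rewrite /inc => /or3P[/eqP->|/eqP->|/andP[_ /eqP->]]; lia.
Qed.

(** A triangle with an outside owner and a vertex strictly below the edge would have a side crossing
    the edge, or a spoke below it. Hence vertices below an edge can only be matched with triangles
    owned below it. *)
Lemma inc_inside_l (u v w x : int) : E u v -> u < x < v -> inc x w -> u < w < v.
Proof.
move=> Euv h; case: (enclosing Euv h) => nx a b.
rewrite /inc => /or3P[/eqP<- //|/eqP|/andP[]].
  move=> e; have [Ewr sr wr|Elw Ewr Elr lw wr] := fanP w.
    by rewrite -e (negbTE nx) in sr.
  rewrite -e in Ewr Elr wr.
  move: (E_nc Ewr Euv) (E_nc Elr Euv) => n1 n2; lia.
case: (fanP w) => // Elw Ewr Elr lw wr _ /eqP e.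
rewrite -e in Elw Elr lw.
move: (E_nc Euv Elw) (E_nc Euv Elr) => n1 n2; lia.
Qed.

(** Every other triangle at [x] lies below one of the two short sides of the triangle owned by [x].
    The width [R w - L w] therefore serves as a potential. *)
Lemma inc_deeper (x w : int) : ~~ sp x -> inc x w -> w != x -> R w - L w < R x - L x.
Proof.
move=> nx; case: (fanP x) nx => // Elx Exr Elr lx xr _.
rewrite /inc => /or3P[/eqP->|/eqP e|/andP[]]; first by rewrite eqxx.
  have [Ewr sr wr|Elw Ewr Elrw lw wr] := fanP w.
    by move: (E_sp Elr sr); lia.
  by move: (E_nc Elrw Elr); lia.
case: (fanP w) => // Elw Ewr Elrw lw wr _ /eqP e _.
move: (E_nc Elr Elrw); lia.
Qed.

(** An edge from [u] reaching beyond [R u] would cross the long side of the triangle of [u], or pass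
    over the spoke [R u]. *)
Lemma R_ge (u y : int) : E u y -> y <= R u.
Proof.
move=> Euy; have uy := E_lt Euy.
have [_ sr ur|_ _ Elr lu ur] := fanP u.
  by move: (E_sp Euy sr); lia.
by move: (E_nc Elr Euy); lia.
Qed.

(** The owner of the triangle lying directly above the edge from [u] to [y]. *)
Definition top (u y : int) : int := if R u == y then u else y.

Lemma L_top (u y : int) : E u y -> R u != y -> ~~ sp y /\ L y = u.
Proof.
move=> Euy ne; have uy := E_lt Euy; have ru := R_ge Euy.
have Eur : E u (R u) by have [] := fanP u.
have [ny le1 _] : [/\ ~~ sp y, u <= L y & R y <= R u].
  by apply: enclosing => //; lia.
split => //; case: (fanP y) ny => // Ely Eyr Elr ly yr _.
by move: (E_nc Euy Elr); lia.
Qed.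

(** Exactly one triangle lies above an edge; every other triangle containing both ends lies below it
    and is owned there. *)
Lemma topP (u y w : int) : E u y ->
  (inc u w && inc y w && ~~ (u < w < y)) = (w == top u y).
Proof.
move=> Euy; have uy := E_lt Euy; have ru := R_ge Euy.
rewrite /top; apply/idP/eqP => [/andP[/andP[]]|->].
  have := L_top Euy; rewrite /inc.
  case: eqP => [e _|ne /(_ isT)[ny ly]]; last first.
    case: (eqVneq w u) => [->|wu]; first by have [] := fanP u; lia.
    by case: (fanP w) => [? ? ?|? ? ? ? ?] /=; lia.
  case: (eqVneq w y) => [->|wy]; last first.
    by case: (fanP w) => [? ? ?|? ? ? ? ?] /=; lia.
  have := spoke_side (x := u); rewrite e.
  case: (fanP y) => [? ? ?|Ely Eyr Elr lty yr] /=; first lia.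
  case: (fanP u) e => [_ _ _ _ /(_ isT)[]//|_ _ Elru ? ? e _].
  by move: (E_nc Elru Elr); lia.
case: eqP => e; rewrite /inc.
  by rewrite -e !eqxx orbT ltxx.
case: (L_top Euy) => [|-> ->]; first exact/eqP.
by rewrite !eqxx !orbT ltxx andbF.
Qed.

(** A triangle shared by [y] and some [t] left of [u] puts an edge ending at [y] over [u]. So [u]
    owns a triangle with right end [y], and [L u] is the next neighbour of [y] to the left. *)
Lemma inc_below_top (u y t w : int) : E u y -> t < u -> inc t w -> inc y w ->
  [/\ ~~ sp u, R u = y & t <= L u].
Proof.
move=> Euy tu tw yw; have uy := E_lt Euy; have ru := R_ge Euy.
have [wy|[wuy|[wu|wu]]] : w = y \/ u < w < y \/ w = u \/ w < u.
- by move: tw yw; rewrite /inc; case: (fanP w) => /=; lia.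
- rewrite wy in tw; move: tw; rewrite /inc.
  case: (fanP y) => [? ? ?|Ely Eyr Elr ly yr] /=; first lia.
  move=> tL; have [] := enclosing Ely (x := u); first lia.
  by move=> -> *; split => //; lia.
- by have := inc_inside Euy wuy tw; lia.
- rewrite wu in tw yw; move: tw yw; rewrite /inc.
  by case: (fanP u) => [? ? ?|? ? ? ? ?] /=; split => //; lia.
have Rw : R w = y by move: yw; rewrite /inc; case: (fanP w) => /=; lia.
have Ewy : E w y by rewrite -Rw; case: (fanP w).
have [|-> *] := enclosing Ewy (x := u); first lia.
split => //; first lia.
by move: tw; rewrite /inc; case: (fanP w) => [? ? ?|? ? ? ? ?] /=; lia.
Qed.

(** * Matchings below an edge and collisions with a new vertex *)

Variable (I : int -> seq int).
Hypothesis I_uniq : forall x, uniq (I x).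
Hypothesis mem_I : forall x w : int, (w \in I x) = inc x w.

Local Notation mt := (matching_seqs I).

Definition middles (p : int) (a b : nat) : seq int :=
  [seq p + t%:Z | t <- iota a.+1 (b - a.+1)].

Lemma middles_uniq (p : int) a b : uniq (middles p a b).
Proof. by rewrite map_inj_uniq ?iota_uniq // => s t; lia. Qed.

Lemma mem_middles (p : int) a b (x : int) :
  (x \in middles p a b) = (p + a%:Z < x < p + b%:Z).
Proof.
apply/mapP/idP => [[t]|h]; first by rewrite mem_iota => h ->; lia.
by exists `|x - p|%N; rewrite ?mem_iota; lia.
Qed.

Lemma nth_middles (p : int) a b i :
  (i < b - a.+1)%N -> nth 0 (middles p a b) i = p + (a.+1 + i)%:Z.
Proof. by move=> ib; rewrite (nth_map 0%N) ?size_iota ?nth_iota. Qed.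

Lemma inc_refl (x : int) : inc x x.
Proof. by rewrite /inc eqxx. Qed.

(* Below an edge a matching is an injective self-map of a finite set which moves
   no vertex towards a wider triangle, hence the identity. *)
Lemma matching_under (p : int) a b (f : seq int) : (a < b)%N -> E (p + a%:Z) (p + b%:Z) ->
  f \in mt p b ->
  drop a.+1 f = middles p a b /\ ~~ (p + a%:Z < nth 0 f a < p + b%:Z).
Proof.
move=> ab Eab /mem_matching_seqs[sf uf hf].
have hf' t : (t < b)%N -> inc (p + t%:Z) (nth 0 f t).
  by move=> tb; rewrite -mem_I hf.
set g := drop a.+1 f.
have sg : size g = (b - a.+1)%N by rewrite size_drop sf.
have ug : uniq g by apply: drop_uniq.
have gn i : nth 0 g i = nth 0 f (a.+1 + i) by rewrite nth_drop.
(* The inner vertices use only inner owners, and there are equally many of both, so [g] is a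
   permutation of [middles p a b]. *)
have sub : {subset g <= middles p a b}.
  move=> x /(nthP 0)[i]; rewrite sg gn => ib <-.
  rewrite mem_middles; apply: (inc_inside_l Eab _ (hf' _ _)); lia.
have sm : size (middles p a b) = (b - a.+1)%N by rewrite size_map size_iota.
have [_ gi] : (size g = size (middles p a b)) * (g =i middles p a b).
  by apply: uniq_min_size => //; rewrite sm sg.
have pg : perm_eq g (middles p a b).
  by apply: uniq_perm; rewrite ?middles_uniq //; apply: gi.
(* All inner owners are taken by the inner vertices, so injectivity keeps entry [a] outside. *)
split; last first.
  rewrite -mem_middles -gi.
  by have := drop_uniq a uf; rewrite (drop_nth 0) ?sf // => /andP[].
(* A permutation preserves the total width, while each entry has at most the width of its own
   position; equality of the sums forces equality termwise. *)
pose phi w := R w - L w.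
have e : \sum_(i < b - a.+1) phi (nth 0 g i) =
         \sum_(i < b - a.+1) phi (nth 0 (middles p a b) i).
  rewrite -(big_mkord xpredT (fun i => phi (nth 0 g i))).
  rewrite -(big_mkord xpredT (fun i => phi (nth 0 (middles p a b) i))).
  rewrite -{1}sg -sm.
  by rewrite -!(big_nth 0 xpredT phi); apply: perm_big.
have le (i : 'I_(b - a.+1)) : xpredT i ->
    phi (nth 0 g i) <= phi (nth 0 (middles p a b) i)
    ?= iff (nth 0 g i == nth 0 (middles p a b) i).
  move=> _; rewrite nth_middles // gn.
  have ib := ltn_ord i.
  have inx : inc (p + (a.+1 + i)%:Z) (nth 0 f (a.+1 + i)) by apply: hf'; lia.
  have [|nx _ _] := enclosing Eab (x := p + (a.+1 + i)%:Z); first lia.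
  have [->|ne] := eqVneq (nth 0 f (a.+1 + i)) (p + (a.+1 + i)%:Z).
    by split; rewrite ?eqxx.
  move: (inc_deeper nx inx ne) => lt; rewrite -/(phi _) -/(phi _) in lt.
  by split; [exact: ltW|exact: lt_eqF].
have /forallP eqs : [forall (i : 'I_(b - a.+1) | xpredT i),
    nth 0 g i == nth 0 (middles p a b) i].
  by rewrite -(leif_sum le).2 e eqxx.
apply: (@eq_from_nth _ 0); first by rewrite sg sm.
by move=> i; rewrite sg => ib; apply/eqP; apply: (eqs (Ordinal ib)).
Qed.

(** Once entry [a] is fixed to be [w], all later entries are forced by the edge. The first [a]
    entries are never owned strictly below the edge, so they only have to avoid [w]. *)
Lemma count_top (p : int) a b (w : int) :
  (a < b)%N -> E (p + a%:Z) (p + b%:Z) -> inc (p + a%:Z) w ->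
  ~~ (p + a%:Z < w < p + b%:Z) ->
  count (fun f => nth 0 f a == w) (mt p b) =
  count (fun h : seq int => w \notin h) (mt p a).
Proof.
move=> ab Eab aw wout.
apply: (@count_bij _ _ _ _ _ _ (take a) (fun h => rcons h w ++ middles p a b)).
- exact: matching_seqs_uniq.
- exact: matching_seqs_uniq.
- move=> f fm /eqP fa; have [dr _] := matching_under ab Eab fm.
  case/mem_matching_seqs: fm => sf uf hf.
  have fE : f = rcons (take a f) w ++ middles p a b.
    by rewrite -dr -fa -take_nth ?sf // cat_take_drop.
  split => //.
    apply/mem_matching_seqs; split; first by rewrite size_takel // sf ltnW.
      exact: take_uniq.
    by move=> t ta; rewrite nth_take // hf // (ltn_trans ta).
  by move: uf; rewrite {1}fE cat_uniq rcons_uniq => /andP[/andP[]].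
move=> h /mem_matching_seqs[sh uh hh] wh.
split; last 2 first.
- by rewrite nth_cat size_rcons sh ltnSn nth_rcons sh ltnn eqxx.
- by rewrite -cats1 -catA take_size_cat.
apply/mem_matching_seqs; split.
- by rewrite size_cat size_rcons sh size_map size_iota subnKC.
- rewrite cat_uniq rcons_uniq wh uh middles_uniq !andbT /=.
  apply/hasPn => x; rewrite mem_middles => xab.
  rewrite mem_rcons inE negb_or; apply/andP; split.
    by apply: contra wout => /eqP <-.
  apply/negP => /(nthP 0)[t]; rewrite sh => ta xt.
  move: (hh t ta); rewrite xt mem_I => /(inc_inside Eab xab); lia.
- move=> t tb; rewrite nth_cat size_rcons sh.
  case: ltnP => ta.
    rewrite nth_rcons sh; case: ltnP => ta'; first exact: hh.
    have -> : t = a by lia.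
    by rewrite eqxx mem_I.
  rewrite nth_middles; last lia.
  by rewrite subnKC // mem_I inc_refl.
Qed.

Lemma count0 (T : eqType) (P : pred T) (l : seq T) :
  (forall x, x \in l -> ~~ P x) -> count P l = 0%N.
Proof. by move=> h; apply/eqP; rewrite -leqn0 leqNgt -has_count; apply/hasPn. Qed.

(** Strong induction along the chain of left neighbours of [y]. The term [t = a] counts the
    matchings of the first [a] vertices avoiding the triangle above the edge; the smaller [t]
    together count those using it. *)
Lemma collisions (p : int) a s : (a < s)%N -> E (p + a%:Z) (p + s%:Z) ->
  (\sum_(0 <= t < a.+1)
     count (fun f => nth 0%R f t \in I (p + s%:Z)) (mt p s) = size (mt p a))%N.
Proof.
elim/ltn_ind: a => a IH as_ Eas.
set y := (p + s%:Z) in Eas *; set u := (p + a%:Z) in Eas *.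
have uy : u < y by exact: E_lt.
have := topP (top u y) Eas; rewrite eqxx => /andP[/andP[ut yt] tout].
rewrite big_nat_recr //=.
(* Entry [a] is not owned strictly below the edge, so by [topP] it collides with [y] exactly when it
   is [top u y]. *)
have -> : count (fun f => nth 0 f a \in I y) (mt p s) =
          count (fun h : seq int => top u y \notin h) (mt p a).
  rewrite -(count_top as_) //; apply: eq_in_count => f fm.
  have [_ out] := matching_under as_ Eas fm.
  rewrite -topP // out andbT mem_I.
  by case/mem_matching_seqs: fm => _ _ /(_ a as_); rewrite mem_I => ->.
(* The test asks whether [y] has a further left neighbour [L u] within the range starting at [p]. *)
case: (boolP [&& ~~ sp u, R u == y & p <= L u]) => [/and3P[nu /eqP Ru pL]|no].
  have [Elu _ Elr] := nonspoke_sides nu; have lu := E_lt Elu.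
  have [c cE] : exists c : nat, L u = p + c%:Z by exists `|L u - p|%N; lia.
  have ca : (c < a)%N by lia.
  have -> : top u y = u by rewrite /top Ru eqxx.
  rewrite (big_cat_nat (n := c.+1)) //=.
  rewrite IH //; [|by lia|by rewrite -cE -/y -Ru].
  rewrite big1_seq ?addn0; last first.
    move=> t; rewrite mem_index_iota => /andP[_ /andP[ct ta]].
    apply: count0 => f /mem_matching_seqs[_ _ /(_ t)].
    rewrite !mem_I => h; apply/negP => yf.
    have [||_ _] := inc_below_top Eas _ (h _) yf; lia.
  (* The triangle of [u] has [L u] as its only vertex left of [u], so a matching can use it only at
     position [c]; the first [c] entries are then arbitrary. *)
  have <- : (count (fun h : seq int => u \in h) (mt p a) = size (mt p c))%N.
    transitivity (count (fun h => nth 0 h c == u) (mt p a)).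
      apply: eq_in_count => h /mem_matching_seqs[sh uh hh].
      apply/idP/eqP => [/(nthP 0)[t]|<-]; last by rewrite mem_nth ?sh.
      rewrite sh => ta tu; rewrite -tu; congr nth.
      by move: (hh t ta); rewrite tu mem_I /inc; case: (fanP u) nu => //=; lia.
    rewrite count_top //.
    - rewrite -count_predT; apply: eq_in_count => h /mem_matching_seqs[sh uh hh].
      apply/negP => /(nthP 0)[t]; rewrite sh => ta tu.
      by move: (hh t ta); rewrite tu mem_I /inc; case: (fanP u) nu => //=; lia.
    - by rewrite -cE.
    - by rewrite -cE /inc nu eqxx !orbT.
    - by rewrite -/u ltxx andbF.
  by rewrite -(count_predC (fun h : seq int => u \in h) (mt p a)).
rewrite big1_seq ?add0n; last first.
  move=> t; rewrite mem_index_iota => /andP[_ /andP[_ ta]].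
  apply: count0 => f /mem_matching_seqs[_ _ /(_ t)].
  rewrite !mem_I => h; apply/negP => yf.
  have [||nu Ru tL] := inc_below_top Eas _ (h _) yf; [lia|lia|].
  by move: no; rewrite nu Ru eqxx /=; lia.
(* The chain ends here: the triangle above the edge has no vertex in the range to the left of [u],
   so every matching avoids it. *)
rewrite -count_predT; apply: eq_in_count => h /mem_matching_seqs[sh uh hh].
apply/negP => /(nthP 0)[t]; rewrite sh => ta.
move: (hh t ta) => + tw; rewrite tw mem_I /top; case: eqP => Ru.
  move: no; rewrite Ru eqxx /= /inc.
  by case: (fanP u) => [? ? ?|? ? ? ? ?] /=; lia.
have [|ny ly] := L_top Eas; first exact/eqP.
by rewrite /inc; case: (fanP y) => [? ? ?|? ? ? ? ?] /=; lia.
Qed.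

(** The chain of neighbours of the new vertex starts at its immediate predecessor, so [collisions]
    applies with [a = s] and sums over all positions. *)
Lemma size_matching_seqs_rec (p : int) s :
  (size (mt p s.+2) + size (mt p s) =
   size (I (p + s.+1%:Z)) * size (mt p s.+1))%N.
Proof.
rewrite -size_matching_seqsS // collisions // -[s.+1]addn1 PoszD addrA.
exact: E_succ.
Qed.

End FanSystem.

(** * Arcs of a periodic triangulation *)

Definition spoke (T : set (vertex * vertex)) (x : int) : bool :=
  `[< exists k, T (inl k, inr x) >].

(** Boundary segments are included so that all sides of triangles between lower vertices are treated
    alike. *)
Definition edge (T : set (vertex * vertex)) (u v : int) : bool :=
  (v == u + 1) || `[< T (inr u, inr v) >].

(* [L x] and [R x] are the other lower vertices of the triangle owned by [x]: the
   one having [x] in the middle or, if [x] is joined to the upper boundary, the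
   one with side from [x] to the next such vertex [R x]. *)
Definition sides (T : set (vertex * vertex)) (L R : int -> int) : Prop :=
  forall x, if spoke T x then edge T x (R x) /\ spoke T (R x)
            else [/\ edge T (L x) x, edge T x (R x) & edge T (L x) (R x)].

(** The superscript of the vertex at position [x]; the shift by one is there because indices run
    over [1..n]. *)
Definition sup (n : nat) (x : int) : int := ((x - 1) %/ n%:Z)%Z.

Lemma supP n x : (0 < n)%N -> superscript n x (sup n x).
Proof.
rewrite /superscript /position /sup => n0.
have := divz_eq (x - 1) n; have := ltz_pmod (x - 1) (d := n).
have := modz_ge0 (x - 1) (d := n); lia.
Qed.

Lemma sup_uniq n x k : (0 < n)%N -> superscript n x k -> k = sup n x.
Proof.
by move=> n0; have := supP x n0; rewrite /superscript /position; nia.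
Qed.

Lemma shift_arcD n l l' a :
  shift_arc n l (shift_arc n l' a) = shift_arc n (l + l') a.
Proof.
by case: a => [[u|u] [v|v]]; rewrite /shift_arc /=; do ?congr pair;
  congr (_ _); ring.
Qed.

Section Strip.
Variables (n : nat) (T : set (vertex * vertex)).
Hypothesis n_gt0 : (0 < n)%N.
Hypothesis perT : periodic_triangulation n T.

Lemma T_arc a : T a -> is_arc n a.
Proof. by case: perT => [[[h _] _] _]; apply: h. Qed.

Lemma T_noncrossing a b : T a -> T b -> ~~ crossing a b.
Proof. by case: perT => [[[_ h] _] _]; apply: h. Qed.

Lemma crossing_sym a b : crossing a b = crossing b a.
Proof. by case: a b => [[u|u] [v|v]] [[r|r] [s|s]] //=; lia. Qed.

Lemma crossing_refl a : is_arc n a -> ~~ crossing a a.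
Proof. by case: a => [[u|u] [v|v]] //=; lia. Qed.

(** Otherwise adding [a] would contradict the maximality of [T]. *)
Lemma crossing_ex a : is_arc n a -> ~ T a -> exists2 b, T b & crossing a b.
Proof.
move=> arca nTa; apply: contrapT => h; apply: nTa.
have nc b : T b -> ~~ crossing a b.
  by move=> Tb; apply/negP => ab; apply: h; exists b.
case: perT => [[_ /(_ (T `|` [set a]))] +] _ => <- //; first by right.
  split=> [b [/T_arc//|->//]|b c [Tb|->] [Tc|->]].
  - exact: T_noncrossing.
  - by rewrite crossing_sym nc.
  - exact: nc.
  - exact: crossing_refl.
Qed.

Lemma T_shift l a : T a -> T (shift_arc n l a).
Proof.
case: perT => [_ [i [k [_ [_ _ h]]]]] /h[l' [b [Tb b1 b2 ->]]].
by rewrite shift_arcD; apply/h; exists (l + l'), b.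
Qed.

Lemma spoke_shift l x : spoke T (x + l * n%:Z) = spoke T x.
Proof.
apply/idP/idP => /asboolP[k Tk]; apply/asboolP.
  exists (k - l); have := T_shift (- l) Tk; rewrite /shift_arc /=.
  by have -> : x + l * n + - l * n = x by ring.
by exists (k + l); apply: (T_shift l Tk).
Qed.

Lemma edge_shift l u v : edge T (u + l * n%:Z) (v + l * n%:Z) = edge T u v.
Proof.
rewrite /edge; congr (_ || _); first by lia.
apply/idP/idP => /asboolP Ta; apply/asboolP.
  have := T_shift (- l) Ta; rewrite /shift_arc /=.
  by rewrite !mulNr !addrK.
exact: (T_shift l Ta).
Qed.

Lemma spoke_in k : exists2 x, spoke T x & superscript n x k.
Proof.
case: perT => _ [i [l [hi [Tl _ _]]]]; exists (i + k * n%:Z).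
  have -> : i + k * n%:Z = i + l * n%:Z + (k - l) * n%:Z by ring.
  by rewrite spoke_shift; apply/asboolP; exists l.
rewrite /superscript /position; lia.
Qed.

Lemma T_sup k x : T (inl k, inr x) -> k = sup n x.
Proof. by move=> /T_arc; apply: sup_uniq. Qed.

Lemma spokeP x : reflect (T (inl (sup n x), inr x)) (spoke T x).
Proof.
apply: (iffP (asboolP _)) => [[k Tk]|Tx]; last by exists (sup n x).
by rewrite -(T_sup Tk).
Qed.

Lemma edge_lt u v : edge T u v -> u < v.
Proof. by move=> /orP[/eqP->|/asboolP/T_arc/andP[]]; lia. Qed.

Lemma edge_succ u : edge T u (u + 1).
Proof. by rewrite /edge eqxx. Qed.

Lemma edge_arc u v : edge T u v -> u + 1 < v -> T (inr u, inr v).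
Proof. by move=> /orP[/eqP->|/asboolP//]; lia. Qed.

Lemma edge_noncrossing u v r s :
  edge T u v -> edge T r s -> ~~ ((u < r < v) && (v < s)).
Proof.
move=> uv rs; apply/negP => h.
have := T_noncrossing (edge_arc uv _) (edge_arc rs _) => /=; lia.
Qed.

Lemma edge_spoke u v x : edge T u v -> spoke T x -> ~~ (u < x < v).
Proof.
move=> uv /spokeP Tx; apply/negP => h.
by have := T_noncrossing (edge_arc uv _) Tx => /=; lia.
Qed.

(** Any [n] consecutive positions contain a spoke, and an edge cannot pass over one. *)
Lemma edge_le u v : edge T u v -> v <= u + n%:Z.
Proof.
move=> uv; have [x sx hx] := spoke_in (sup n (u + 1)).
have := supP (u + 1) n_gt0; move: hx; rewrite /superscript /position => hx hu.
have [ux|ux] := ltP u x; first by have := edge_spoke uv sx; lia.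
by have := edge_spoke uv (x := x + 1 * n%:Z); rewrite spoke_shift sx => /(_ isT); lia.
Qed.

Lemma not_edge_crossing u v : u < v -> ~~ edge T u v ->
  (exists2 x, spoke T x & u < x < v) \/
  (exists r s, T (inr r, inr s) /\ ((u < r < v) && (v < s) || (r < u < s) && (s < v))).
Proof.
move=> uv; rewrite negb_or => /andP[ne /asboolPn nT].
have [|[[k|r] [l|s]] Tb /=] := crossing_ex _ nT.
- by rewrite /=; lia.
- by [].
- by move=> h; left; exists s => //; apply/asboolP; exists k.
- by [].
by move=> h; right; exists r, s; split => //; lia.
Qed.

(** Induction on the length of an arc over [x]. If [x] is not connected to one of its ends, whatever
    crosses the missing edge is a shorter arc, nested in the first and still over [x]. *)
Lemma minimal_arc x r s : T (inr r, inr s) -> r < x < s ->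
  exists u v, [/\ edge T u x, edge T x v & edge T u v].
Proof.
have [k] := ubnP `|s - r|%N; elim: k r s => [//|k IH] r s sk Trs rxs.
have Ers : edge T r s by apply/orP; right; apply/asboolP.
have [rx|/not_edge_crossing] := boolP (edge T r x); last first.
  case=> [|[y sy hy]|[r' [s' [T' h']]]]; first lia.
    by have := edge_spoke Ers sy; lia.
  have E' : edge T r' s' by apply/orP; right; apply/asboolP.
  have := edge_noncrossing Ers E'; have := edge_noncrossing E' Ers => n1 n2.
  by apply: (IH r' s') => //; lia.
have [xs|/not_edge_crossing] := boolP (edge T x s); last first.
  case=> [|[y sy hy]|[r' [s' [T' h']]]]; first lia.
    by have := edge_spoke Ers sy; lia.
  have E' : edge T r' s' by apply/orP; right; apply/asboolP.
  have := edge_noncrossing Ers E'; have := edge_noncrossing E' Ers => n1 n2.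
  by apply: (IH r' s') => //; lia.
by exists r, s.
Qed.

(** The missing arc from [x] to the upper boundary is crossed by some arc. Arcs to the upper
    boundary respect the order of superscripts and do not cross it, so a lower arc passes over
    [x]. *)
Lemma nonspoke_enclosed x : ~~ spoke T x ->
  exists u v, [/\ edge T u x, edge T x v & edge T u v].
Proof.
move=> /spokeP nT; have [|[[l|r] [q|s]] Tb //=] := crossing_ex _ nT.
- exact: supP.
- have := T_arc Tb; have := supP x n_gt0.
  by rewrite /= /superscript /position; nia.
- by move=> h; apply: minimal_arc Tb _.
Qed.

(** The first spoke after [x] works: an obstruction to the edge would be an earlier spoke, or a
    lower arc passing over [x] or over that spoke. *)
Lemma next_spoke x : spoke T x -> exists2 v, edge T x v & spoke T v.
Proof.
move=> sx; have ex : exists d : nat, spoke T (x + d.+1%:Z).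
  (* The translate of [x] by one period; the search is over [d.+1] to stay strictly to the right of
     [x]. *)
  by exists n.-1; rewrite prednK // -[n%:Z]mul1r spoke_shift.
have [d sd dmin] := ex_minnP ex; exists (x + d.+1%:Z) => //.
apply: contraT => /not_edge_crossing[|[y sy hy]|[r [s [Trs h]]]]; first lia.
  have := dmin `|(y - x - 1)%R|%N; have -> : x + `|(y - x - 1)%R|.+1%:Z = y by lia.
  by rewrite sy => /(_ isT); lia.
have Ers : edge T r s by apply/orP; right; apply/asboolP.
by have := edge_spoke Ers sx; have := edge_spoke Ers sd; lia.
Qed.

Lemma sides_ex : exists L R, sides T L R.
Proof.
have h x : exists uv : int * int,
    if spoke T x then edge T x uv.2 /\ spoke T uv.2
    else [/\ edge T uv.1 x, edge T x uv.2 & edge T uv.1 uv.2].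
  case: (boolP (spoke T x)) => [/next_spoke[v xv sv]|/nonspoke_enclosed[u [v uxv]]].
    by exists (x, v).
  by exists (u, v).
have [f hf] := choice h.
by exists (fun x => (f x).1), (fun x => (f x).2).
Qed.

End Strip.

(** * Classification of the triangles *)

(** An increasing path cannot jump over [y]; this locates given vertices on the lower side of a
    region. *)
Lemma path_mem (e : rel int) (x : int) (s : seq int) (y : int) :
  (forall u v, e u v -> u < v) -> path e x s -> x <= y <= last x s ->
  (forall u v, e u v -> x <= u -> ~~ (u < y < v)) -> y \in x :: s.
Proof.
move=> e_lt; elim: s x => [|z s IH] x /=; first by rewrite inE => _; lia.
move=> /andP[xz zs] xys h; rewrite inE.
have [//|yx] := eqVneq y x.
have := h _ _ xz (lexx _) => nxz.
apply: (IH z) => //; first lia.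
by move=> u v uv zu; apply: h => //; have := e_lt _ _ xz; lia.
Qed.

Lemma lt_path_last (x y : int) (s : seq int) :
  path <%R x (y :: s) -> x < last y s.
Proof. by move=> /(order_path_min lt_trans)/allP/(_ _ (mem_last y s)). Qed.

Lemma next3 (V : eqType) (a b c u v : V) :
  uniq [:: a; b; c] -> u \in [:: a; b; c] -> v \in [:: a; b; c] -> u != v ->
  v = next [:: a; b; c] u \/ u = next [:: a; b; c] v.
Proof.
rewrite /= !inE !negb_or andbT => /andP[/andP[ab ac] bc].
move=> /or3P[]/eqP-> /or3P[]/eqP->; rewrite ?eqxx //;
  rewrite ?(eq_sym b a) ?(eq_sym c a) ?(eq_sym c b);
  rewrite ?(negbTE ab) ?(negbTE ac) ?(negbTE bc); by [left|right].
Qed.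

Lemma next4 (V : eqType) (a b c d u v : V) :
  uniq [:: a; b; c; d] -> u \in [:: a; b; c; d] -> v \in [:: a; b; c; d] ->
  u != v -> (u, v) \notin [:: (a, c); (c, a); (b, d); (d, b)] ->
  v = next [:: a; b; c; d] u \/ u = next [:: a; b; c; d] v.
Proof.
rewrite /= !inE !negb_or andbT !xpair_eqE.
move=> /and3P[/and3P[ab ac ad] /andP[bc bd] cd].
move=> /or4P[]/eqP-> /or4P[]/eqP->; rewrite ?eqxx //=;
  rewrite ?(eq_sym b a) ?(eq_sym c a) ?(eq_sym c b) ?(eq_sym d a)
    ?(eq_sym d b) ?(eq_sym d c);
  rewrite ?(negbTE ab) ?(negbTE ac) ?(negbTE bc) ?(negbTE ad) ?(negbTE bd)
    ?(negbTE cd) ?orbT //=; by [left|right].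
Qed.

Definition side (T : set (vertex * vertex)) (u v : vertex) : bool :=
  neighbors u v || `[< joined T u v >].

(** [undup] merges the upper ends of two consecutive spokes with equal superscripts; distinct ones
    give a four-sided region. *)
Definition owned_region (n : nat) (T : set (vertex * vertex)) (L R : int -> int)
    (x : int) : region :=
  if spoke T x then (undup [:: sup n x; sup n (R x)], [:: x; R x])
  else ([::], [:: L x; x; R x]).

Lemma incident_lower (r : region) p : incident r (inr p) = (p \in r.2).
Proof.
rewrite /incident /contour mem_cat mem_map; last by move=> ? ? [].
by rewrite orbC; case: mapP => // -[].
Qed.

Lemma contour_uniq (r : region) :
  sorted <%R r.1 -> sorted <%R r.2 -> uniq (contour r).
Proof.
move=> s1 s2; rewrite cat_uniq !map_inj_uniq; try by move=> ? ? [].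
rewrite rev_uniq !lt_sorted_uniq // andbT /=.
by apply/hasPn => v /mapP[k _ ->]; apply/mapP => -[].
Qed.

Section Regions.
Variables (n : nat) (T : set (vertex * vertex)) (L R : int -> int).
Hypothesis n_gt0 : (0 < n)%N.
Hypothesis perT : periodic_triangulation n T.
Hypothesis sdT : sides T L R.

Let E_lt := edge_lt n_gt0 perT.
Let E_nc := edge_noncrossing n_gt0 perT.
Let E_sp := edge_spoke n_gt0 perT.

Lemma nonspoke_sides x : ~~ spoke T x ->
  [/\ edge T (L x) x, edge T x (R x) & edge T (L x) (R x)].
Proof. by move=> nx; have := sdT x; rewrite (negbTE nx). Qed.

Lemma spoke_side x : spoke T x -> edge T x (R x) /\ spoke T (R x).
Proof. by move=> sx; have := sdT x; rewrite sx. Qed.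

Let encl := enclosing E_lt E_nc E_sp nonspoke_sides spoke_side.

(** The edge to [R x] would otherwise pass over a spoke of the next block. *)
Lemma sup_R x : spoke T x -> sup n x <= sup n (R x) <= sup n x + 1.
Proof.
move=> sx; have [xR _] := spoke_side sx; have ltxR := E_lt xR.
have [y sy] := spoke_in n_gt0 perT (sup n x + 1).
move: (E_sp xR sy) (supP x n_gt0) (supP (R x) n_gt0).
rewrite /superscript /position; nia.
Qed.

Lemma joined_lower p q : p < q -> joined T (inr p) (inr q) -> T (inr p, inr q).
Proof. by move=> pq [|/(T_arc perT)/=] //; lia. Qed.

Lemma joined_upper k p : joined T (inl k) (inr p) -> spoke T p /\ k = sup n p.
Proof.
case=> [Tkp|/(T_arc perT)//]; split; last exact: (T_sup n_gt0 perT).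
by apply/asboolP; exists k.
Qed.

Lemma joinedC u v : joined T u v -> joined T v u.
Proof. by case; [right|left]. Qed.

Lemma joined_neq u v : joined T u v -> u != v.
Proof.
by move=> uv; apply/eqP => e; subst v; case: uv => /(T_arc perT);
  case: u => //= p; rewrite ltxx.
Qed.

Lemma joined_uppers k l : ~ joined T (inl k) (inl l).
Proof. by case=> /(T_arc perT). Qed.

Lemma side_edge p q : p < q -> side T (inr p) (inr q) = edge T p q.
Proof.
move=> pq; apply/orP/orP => -[].
- by rewrite /= => e; left; lia.
- by move=> /asboolP/(joined_lower pq) ?; right; apply/asboolP.
- by move=> e; left => /=; lia.
- by move=> /asboolP ?; right; apply/asboolP; left.
Qed.

Lemma sideC u v : side T u v = side T v u.
Proof.
rewrite /side; congr (_ || _); first by case: u v => [u|u] [v|v] //=; lia.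
by apply/asboolP/asboolP => /joinedC.
Qed.

Lemma side_upper k p : side T (inl k) (inr p) = spoke T p && (k == sup n p).
Proof.
apply/orP/andP => [[//|/asboolP/joined_upper[-> ->]]//|[/(spokeP n_gt0 perT) + /eqP->]].
by move=> Tp; right; apply/asboolP; left.
Qed.

Lemma side_uppers k l : k < l -> side T (inl k) (inl l) = (l == k + 1).
Proof.
move=> kl; apply/orP/eqP => [[/=|/asboolP/joined_uppers//]|->]; first by lia.
by left => /=; lia.
Qed.

Lemma triangleP r : triangle T r <->
  [/\ sorted <%R r.1, sorted <%R r.2, (2 < size (contour r))%N,
      cycle (side T) (contour r) &
      forall u v, u \in contour r -> v \in contour r -> joined T u v ->
        v = next (contour r) u \/ u = next (contour r) v].
Proof.
split=> -[s1 s2 sz h d]; split => //.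
  apply: cycle_from_next; first exact: contour_uniq.
  by move=> v /h[nv|jv]; apply/orP; [left|right; apply/asboolP].
move=> v vc; have := next_cycle h vc.
by move=> /orP[nv|/asboolP jv]; [left|right].
Qed.

Lemma triangle_owned x : triangle T (owned_region n T L R x).
Proof.
apply/triangleP; rewrite /owned_region.
case: (boolP (spoke T x)) => [sx|nx]; last first.
  have [Elx ExR ELR] := nonspoke_sides nx.
  have Lx := E_lt Elx; have xR := E_lt ExR; have LR := E_lt ELR.
  have sL : sorted <%R [:: L x; x; R x] by rewrite /= Lx xR.
  have uc := @contour_uniq ([::], _) isT sL.
  split => //.
    by rewrite /contour /= (side_edge Lx) (side_edge xR) sideC (side_edge LR) Elx ExR ELR.
  by move=> u v uu vv /joined_neq; apply: next3.
have [ExR sR] := spoke_side sx; have xR := E_lt ExR.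
have sL : sorted <%R [:: x; R x] by rewrite /= xR.
have := sup_R sx; have [e _|ne supR] := eqVneq (sup n x) (sup n (R x)).
  have -> : undup [:: sup n x; sup n (R x)] = [:: sup n x].
    by rewrite e /= inE eqxx.
  have uc := @contour_uniq ([:: sup n x], _) isT sL.
  split => //.
    by rewrite /contour /= (side_edge xR) ExR sideC !side_upper sx sR e !eqxx.
  by move=> u v uu vv /joined_neq; apply: next3.
have sE : sup n (R x) = sup n x + 1 by lia.
have -> : undup [:: sup n x; sup n (R x)] = [:: sup n x; sup n x + 1].
  by rewrite /= inE (negbTE ne) sE.
have sU : sorted <%R [:: sup n x; sup n x + 1] by rewrite /=; lia.
have uc := @contour_uniq (_, _) sU sL.
split => //.
  rewrite /contour /= (side_edge xR) ExR sideC !side_upper sx sR sE !eqxx /=.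
  by rewrite sideC side_uppers ?eqxx //; lia.
(* Both diagonals of the four-sided region would join an upper and a lower vertex with different
   superscripts. *)
move=> u v uu vv juv; apply: next4 => //; first exact: joined_neq.
rewrite !inE !xpair_eqE; apply/negP.
move=> /or4P[] /andP[/eqP eu /eqP ev]; rewrite eu ev in juv.
- by move/joinedC/joined_upper: juv => [_]; lia.
- by move/joined_upper: juv => [_]; lia.
- by move/joinedC/joined_upper: juv => [_]; lia.
- by move/joined_upper: juv => [_]; lia.
Qed.

Lemma owned_region_inj : injective (owned_region n T L R).
Proof.
move=> x y; rewrite /owned_region; case: ifP => _; case: ifP => _ //.
  by move=> [].
by move=> [].
Qed.

Lemma incident_owned p x :
  incident (owned_region n T L R x) (inr p) = inc (spoke T) L R p x.
Proof.
rewrite incident_lower /owned_region /inc.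
by case: (spoke T x) => /=; rewrite !inE ?orbF // orbC orbA.
Qed.

Lemma edge_path x s : path <%R x s -> path (side T) (inr x) (map inr s) ->
  path (edge T) x s.
Proof.
elim: s x => [//|y s IH] x /= /andP[xy ys] /andP[+ sys].
by rewrite side_edge // => ->; apply: IH.
Qed.

(** Non-crossing makes the triangle with middle vertex [x] unique. *)
Lemma owned_uniq x u v : edge T u x -> edge T x v -> edge T u v ->
  ~~ spoke T x /\ (L x = u /\ R x = v).
Proof.
move=> ux xv uv; have ltux := E_lt ux; have ltxv := E_lt xv.
have [nx uL Rv] : [/\ ~~ spoke T x, u <= L x & R x <= v].
  by apply: encl => //; lia.
have [Lx xR LR] := nonspoke_sides nx.
have ltLx := E_lt Lx; have ltxR := E_lt xR.
have := E_nc ux LR; have := E_nc LR xv.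
by split => //; lia.
Qed.

(** The closing side from [a] to the last vertex [z] passes over [b], so [b] owns a triangle, with
    [L b = a]. Since no arc cuts the region, first [R b = z], and then no vertex lies strictly
    between [b] and [z]. *)
Lemma lower_triangle_owned a b d s :
  triangle T ([::], [:: a, b, d & s]) ->
  ([::], [:: a, b, d & s]) = owned_region n T L R b.
Proof.
move=> /triangleP[_ ltp _]; have uc := @contour_uniq ([::], _) isT ltp.
move: uc; rewrite /contour cats0 [_.2]/= => uc cyc dg.
have /andP[pth] : path (side T) (inr a) (map inr [:: b, d & s]) &&
    side T (last (inr a) (map inr [:: b, d & s])) (inr a).
  by rewrite -rcons_path.
move: (ltp) => /= /andP[ab bs]; move: (bs) => /andP[bd ds].
set z := last d s; have bz : b < z by exact: lt_path_last bs.
rewrite last_map sideC side_edge ?(lt_trans ab bz) // => az.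
have /andP[eab ebs] : edge T a b && path (edge T) b (d :: s).
  exact: edge_path ltp pth.
have [|nb aL Rz] := encl az (x := b); first by rewrite ab.
have [ELb EbR ELR] := nonspoke_sides nb.
have Lb := E_lt ELb; have bR := E_lt EbR; have LR := E_lt ELR.
have La : L b = a by have nc := E_nc eab ELR; clear - nc ab aL Lb bR; lia.
rewrite La in ELR.
have TaR : joined T (inr a) (inr (R b)) by left; apply: (edge_arc n_gt0 ELR); clear - ab bR; lia.
(* A side passing over [R b] would cross the edge from [a] to [R b]. *)
have Rin : R b \in [:: b, d & s].
  apply: (path_mem E_lt ebs); first by rewrite (ltW bR) Rz.
  by move=> u v uv bu; have nc := E_nc ELR uv; clear - nc ab bu; lia.
have zin : z \in [:: b, d & s] by rewrite inE mem_last orbT.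
(* [e] records that the contour increases except for its closing step from [z] to [a]; [next_cycle]
   then limits what can follow a given vertex. *)
pose e (v w : vertex) := if v is inr p then if w is inr q then
  (p < q) || (p == z) && (q == a) else false else false.
have ecyc : cycle e (map inr [:: a, b, d & s]).
  rewrite (_ : cycle _ _ = path e (inr a) (rcons (map inr [:: b, d & s]) (inr a))) //.
  rewrite rcons_path last_map /= !eqxx orbT andbT ab bd /=.
  by rewrite path_map; apply: sub_path ds => p q /= ->.
have mem_inr p : p \in [:: a, b, d & s] ->
    (inr p : vertex) \in map inr [:: a, b, d & s] by apply: map_f.
have nexta : next (map inr [:: a, b, d & s]) (inr a) = inr b :> vertex.
  by rewrite /= eqxx.
have zE : R b = z.
  case: (dg _ _ (mem_inr a _) (mem_inr (R b) _) TaR).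
  - by rewrite inE eqxx.
  - by rewrite inE Rin orbT.
  - by rewrite nexta => -[/eqP]; rewrite gt_eqF.
  have := next_cycle ecyc (mem_inr (R b) _); rewrite inE Rin orbT => /(_ isT).
  by move=> + eR; rewrite -eR /= ltNge (ltW (lt_trans ab bR)) => /andP[/eqP].
have [s0|sn] := eqVneq s [::]; first by rewrite /owned_region (negbTE nb) La zE /z s0.
have dz : d < z.
  by move: ds sn; rewrite /z; case: (s) => // d' s' dl _; apply: lt_path_last dl.
have Tbz : joined T (inr b) (inr z).
  by left; apply: (edge_arc n_gt0); [rewrite -zE|clear - bd dz; lia].
have nextb : next (map inr [:: a, b, d & s]) (inr b) = inr d :> vertex.
  rewrite /= (_ : (inr b == inr a :> vertex) = false) ?eqxx //.
  by apply/eqP => -[/eqP]; rewrite gt_eqF.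
case: (dg _ _ (mem_inr b _) (mem_inr z _) Tbz).
- by rewrite !inE eqxx orbT.
- by rewrite inE zin orbT.
- by rewrite nextb => -[/eqP]; rewrite gt_eqF.
have := next_cycle ecyc (mem_inr z _); rewrite inE zin orbT => /(_ isT).
move=> + eR; rewrite -eR /= ltNge (ltW bz) /= => /andP[_ /eqP ba].
by rewrite ba ltxx in ab.
Qed.

Lemma sup_le p q : p < q -> sup n p <= sup n q.
Proof.
move=> pq; have := supP p n_gt0; have := supP q n_gt0.
by rewrite /superscript /position; nia.
Qed.

(** The extreme lower vertices [x] and [z] are spokes, and [R x] lies on the lower side. Its arc to
    the upper boundary must be a side of the region, so [R x = z], and then the edge from [x] to [z]
    is the whole lower side. *)
Lemma upper_triangle_owned k ks s :
  triangle T (k :: ks, s) -> exists x, (k :: ks, s) = owned_region n T L R x.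
Proof.
move=> /triangleP[]; rewrite [_.1]/= [_.2]/= => uks ls sz cyc dg.
set l := last k ks.
have kl : ks != [::] -> k < l.
  by move: uks; rewrite /l; case: (ks) => // k2 ks' uks _; apply: lt_path_last uks.
case: s => [|x s] in ls sz cyc dg *.
  (* With upper vertices only there are at least three, and the closing side would join upper
     vertices that are not neighbours. *)
  move: cyc sz; rewrite /contour cat0s map_rev rev_cycle size_rev size_map.
  case: ks => [|k2 [|k3 ks]] in uks l kl dg * => // + _.
  have kl2 : k2 < l.
    by rewrite /l; move: uks => /= /andP[_]; apply: (@lt_path_last k2 k3).
  rewrite (_ : cycle _ _ = path (fun v w => side T w v) (inl k)
     (rcons (map inl [:: k2, k3 & ks]) (inl k))) //.
  rewrite rcons_path => /andP[_]; rewrite last_map side_uppers; last exact: kl.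
  have /andP[kk2 _] := uks.
  by rewrite (_ : (l == k + 1) = false) //; clear - kk2 kl2; lia.
set z := last x s.
move: cyc; rewrite [cycle _ _]/= rcons_cat cat_path last_map -/z => /andP[ps].
rewrite rcons_path rev_cons map_rcons last_rcons => /andP[pu].
rewrite side_upper => /andP[sx /eqP kE].
have : path (side T) (inr z) (map inl (rev (k :: ks))).
  by rewrite rev_cons map_rcons.
rewrite {1}lastI rev_rcons -/l [path _ _ _]/= sideC side_upper.
move=> /andP[/andP[sz' /eqP lE] _].
have k2E : ks != [::] -> exists ks', ks = k + 1 :: ks'.
  move: uks pu; case: (ks) => [//|k2 ks'] uks' pu _; exists ks'; congr cons.
  move: pu; rewrite -map_rcons -rev_cons => /path_sorted.
  rewrite map_rev rev_sorted => /andP[+ _]; rewrite sideC side_uppers; first by move/eqP.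
  by case/andP: uks'.
have sn : s != [::].
  apply: contraTneq sz => s0; have lk : l = k by rewrite lE kE /z s0.
  have -> : ks = [::] by apply/eqP; apply: contraT => /kl; rewrite lk ltxx.
  by rewrite s0.
have xz : x < z.
  by move: ls sn; rewrite /z; case: (s) => // y s' ls _; apply: lt_path_last ls.
have [exR sR] := spoke_side sx; have xR := E_lt exR.
have Rz : R x <= z by have := E_sp exR sz'; rewrite xz -leNgt.
have Rin : R x \in x :: s.
  apply: (path_mem E_lt (edge_path ls ps)); first by rewrite (ltW xR).
  by move=> u v uv _; apply: E_sp uv sR.
(* This superscript is [k] or [k + 1] and at most [l]; in the second case [k + 1] is the second
   upper vertex. *)
have kin : sup n (R x) \in k :: ks.
  have := sup_R sx; rewrite -kE inE.
  have [//|ne /andP[kR Rk]] := eqVneq (sup n (R x)) k.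
  have Rk1 : sup n (R x) = k + 1 by clear - ne kR Rk; lia.
  have : sup n (R x) <= l.
    rewrite lE; have [<-//|nRz] := eqVneq (R x) z.
    by apply: sup_le; rewrite lt_neqAle nRz.
  rewrite Rk1 => kl1; have /k2E[ks' ->] : ks != [::].
    by apply/eqP => k0; move: kl1; rewrite /l k0 /=; clear; lia.
  by rewrite inE eqxx.
(* On the contour only [z] passes from lower to upper vertices, and only [x] is reached from an
   upper one. *)
pose e (v w : vertex) := match v, w with
  | inr p, inr q => p < q | inr p, inl _ => p == z
  | inl _, inr q => q == x | inl _, inl _ => true end.
have ecyc : cycle e (contour (k :: ks, x :: s)).
  rewrite /contour [cycle _ _]/= rcons_cat cat_path last_map path_map.
  rewrite (sub_path _ ls) // /=.
  have inl_path m w : path e (inl m) (rcons (map inl w) (inr x)).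
    by elim: w m => [|m' w IH] m /=; rewrite ?eqxx.
  by rewrite lastI rev_rcons /= -/z eqxx inl_path.
have mem_inr p : p \in x :: s -> inr p \in contour (k :: ks, x :: s).
  by move=> ps'; rewrite mem_cat map_f.
have kin' : inl (sup n (R x)) \in contour (k :: ks, x :: s).
  by rewrite mem_cat map_f ?orbT // mem_rev.
have RE : R x = z.
  have jR : joined T (inr (R x)) (inl (sup n (R x))).
    by right; apply/(spokeP n_gt0 perT).
  case: (dg _ _ (mem_inr _ Rin) kin' jR) => h.
    by have := next_cycle ecyc (mem_inr _ Rin); rewrite -h => /eqP.
  have := next_cycle ecyc kin'; rewrite -h /= => /eqP Rx.
  by rewrite Rx ltxx in xR.
have sE : s = [:: z].
  case sE: s sn => [//|y [|y' s']] _; first by rewrite /z sE.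
  have [xy yz] : x < y /\ y < z.
    move: ls; rewrite /z sE /= => /and3P[xy yy' ys]; split => //.
    by apply: (@lt_path_last y y'); rewrite /= yy'.
  have jxz : joined T (inr x) (inr z).
    left; apply: (edge_arc n_gt0); first by rewrite -RE.
    by clear - xy yz; lia.
  have xin : x \in x :: s by rewrite inE eqxx.
  have zin : z \in x :: s by rewrite mem_last.
  case: (dg _ _ (mem_inr _ xin) (mem_inr _ zin) jxz) => h.
    by move: h; rewrite /contour sE /= eqxx => -[zy]; rewrite zy ltxx in yz.
  have := next_cycle ecyc (mem_inr _ zin); rewrite -h /=.
  by rewrite ltNge (ltW xz).
exists x; rewrite /owned_region sx sE RE; congr pair.
rewrite -kE -lE; have [k0|/k2E[ks' ksE]] := eqVneq ks [::].
  by rewrite /l k0 /= inE eqxx.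
have lk1 : l <= k + 1 by rewrite lE -RE kE; case/andP: (sup_R sx).
have ks0 : ks' = [::].
  case: ks' ksE => [//|k3 ks'] ksE.
  move: uks lk1; rewrite /l ksE /= => /andP[_ /lt_path_last].
  by rewrite ltNge => /negP.
rewrite /l ksE ks0 /= inE; case: eqP => //; clear; lia.
Qed.

Lemma triangleE r : triangle T r -> exists x, r = owned_region n T L R x.
Proof.
case: r => [[|k ks] s]; last exact: upper_triangle_owned.
case: s => [|a [|b [|d s]]]; try by move=> /triangleP[].
by move=> /lower_triangle_owned ->; exists b.
Qed.

End Regions.

(** * Friezes and transfer to triangles *)

Section FriezeRecurrence.
Variables (m : int -> int -> int).
Hypothesis frieze_m : infinite_frieze m.

Lemma frieze_gt0 i j : -1 <= j - i -> 0 < m i j.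
Proof.
case: frieze_m => _ m1 mpos _ ij; have [/mpos//|ji] := lerP i j.
have -> : j = i - 1 by lia.
by rewrite m1.
Qed.

(** Induction moving [i] to the left from [j + 1]. The unimodular rules at columns [j - 1] and [j]
    give the identity multiplied by [m (i + 1) j], which is positive and cancels. *)
Lemma frieze_rec i j : -1 <= j - i ->
  m i (j + 1) = m (j + 1) (j + 1) * m i j - m i (j - 1).
Proof.
case: frieze_m => m0 m1 _ muni ij.
have [d ->] : exists d : nat, i = j + 1 - d%:Z.
  by exists `|(j + 1 - i)%R|%N; lia.
elim: d => [|d IH] {i ij}.
  have e0 : m (j + 1) (j - 1) = 0 by rewrite -[RHS](m0 (j + 1)); congr m; ring.
  have e1 : m (j + 1) j = 1 by rewrite -{2}(addrK 1 j) m1.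
  by rewrite !subr0 e0 e1 mulr1 subr0.
set i := j + 1 - d.+1%:Z.
have iE : i + 1 = j + 1 - d%:Z by rewrite /i -addn1 PoszD; ring.
have u1 : m i j * m (i + 1) (j + 1) - m (i + 1) j * m i (j + 1) = 1.
  by apply: muni; rewrite /i; lia.
have u2 : m i (j - 1) * m (i + 1) j - m (i + 1) (j - 1) * m i j = 1.
  by have := muni i (j - 1); rewrite subrK; apply; rewrite /i; lia.
have pos : 0 < m (i + 1) j by apply: frieze_gt0; lia.
rewrite -iE in IH; rewrite IH in u1.
apply: (mulfI (lt0r_neq0 pos)); clear - u1 u2; lia.
Qed.

Lemma frieze_periodic_shift n l i j :
  periodic_frieze n m -> i <= j -> m (i + l * n%:Z) (j + l * n%:Z) = m i j.
Proof.
move=> per; have nat_shift (k : nat) a b : a <= b ->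
    m (a + k%:Z * n%:Z) (b + k%:Z * n%:Z) = m a b.
  elim: k => [|k IH] ab; first by rewrite mul0r !addr0.
  rewrite -IH // [RHS]per; last by lia.
  by congr m; rewrite -addn1 PoszD; ring.
case: l => k ij; first exact: nat_shift.
rewrite NegzE -(nat_shift k.+1); last by lia.
by rewrite mulNr !subrK.
Qed.

(** Both sides satisfy the same second-order recurrence. The [s] vertices end at [p + s - 1], so the
    empty matching corresponds to the entry [m p (p - 1) = 1]. *)
Lemma frieze_size (I : int -> seq int) :
  (forall x, m x x = (size (I x))%:Z) ->
  (forall p s, size (matching_seqs I p s.+2) + size (matching_seqs I p s) =
     size (I (p + s.+1%:Z)%R) * size (matching_seqs I p s.+1))%N ->
  forall p s, m p (p + s%:Z - 1) = (size (matching_seqs I p s))%:Z.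
Proof.
move=> mI rec p s; suff [] : m p (p + s%:Z - 1) = (size (matching_seqs I p s))%:Z /\
    m p (p + s%:Z) = (size (matching_seqs I p s.+1))%:Z by [].
elim: s => [|s [IH1 IH2]].
  case: frieze_m => _ m1 _ _; rewrite addr0 m1 mI; split => //.
  by rewrite /= addr0 cats0 size_map size_filter count_predT.
have sE : p + s.+1%:Z = p + s%:Z + 1 by rewrite -addn1 PoszD addrA.
split; first by rewrite sE addrK.
rewrite sE frieze_rec; last by lia.
rewrite IH1 IH2 mI -sE -PoszM -rec PoszD; ring.
Qed.

End FriezeRecurrence.

Lemma has_card_inj (X : Type) (A : set X) (z z' : int) :
  has_card A z -> has_card A z' -> z = z'.
Proof.
move=> [c Ac ->] [c' Ac' ->]; congr Posz; apply/card_eq_II.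
by apply: card_eq_trans Ac'; rewrite card_eq_sym.
Qed.

Lemma has_card_seq (X : eqType) (Y : Type) (l : seq X) (f : X -> Y) (A : set Y) :
  uniq l -> {in l &, injective f} ->
  (forall y, A y <-> exists2 x, x \in l & y = f x) -> has_card A (size l)%:Z.
Proof.
move=> ul fl Al; exists (size l) => //; case: l => [|x0 l] in ul fl Al *.
  have -> : A = set0; last by rewrite II0 card_eq00.
  by apply/seteqP; split => // y /Al[].
have -> : A = (fun i => f (nth x0 (x0 :: l) i)) @` `I_(size (x0 :: l)).
  apply/seteqP; split => [y /Al[x xl ->]|y [i /= il <-]].
    by exists (index x (x0 :: l)); [rewrite -index_mem in xl|rewrite nth_index].
  by apply/Al; exists (nth x0 (x0 :: l) i) => //; apply: mem_nth.
apply: inj_card_eq => i j; rewrite !inE => il jl /fl.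
by move=> /(_ (mem_nth _ il) (mem_nth _ jl)) /eqP; rewrite nth_uniq // => /eqP.
Qed.

(** * From sets of triangles to lists of owners *)

Section Transfer.
Variables (n : nat) (T : set (vertex * vertex)) (L R : int -> int).
Hypothesis n_gt0 : (0 < n)%N.
Hypothesis perT : periodic_triangulation n T.
Hypothesis sdT : sides T L R.

(** The search window is [x - n] to [x + n], which suffices because edges have length at most
    [n]. *)
Definition owners (x : int) : seq int :=
  [seq w <- [seq x - n%:Z + t%:Z | t <- iota 0 (2 * n).+1] | inc (spoke T) L R x w].

Lemma owners_uniq x : uniq (owners x).
Proof. by rewrite filter_uniq // map_inj_uniq ?iota_uniq // => s t; lia. Qed.

Lemma mem_owners x w : (w \in owners x) = inc (spoke T) L R x w.
Proof.
rewrite mem_filter; case: (boolP (inc _ _ _ _ _)) => // xw; rewrite andTb.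
have [xw1 xw2] : x - n%:Z <= w /\ w <= x + n%:Z.
  have [wR|/andP[]] : edge T w (R w) /\ (x == w) || (x == R w) \/
      ~~ spoke T w && (x == L w).
  - move: xw; rewrite /inc orbA => /orP[h|]; [left; split => //|by right].
    have [sw|nw] := boolP (spoke T w); first by case: (spoke_side sdT sw).
    by case: (nonspoke_sides sdT nw).
  - by have := edge_le n_gt0 perT wR.1; have := edge_lt n_gt0 perT wR.1; lia.
  move=> /(nonspoke_sides sdT)[Lw _ _] /eqP->.
  by have := edge_le n_gt0 perT Lw; have := edge_lt n_gt0 perT Lw; lia.
apply/mapP; exists `|(w - (x - n%:Z))%R|%N; last by lia.
by rewrite mem_iota; lia.
Qed.

Lemma spoke_R_uniq x v : spoke T x -> edge T x v -> spoke T v -> R x = v.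
Proof.
move=> sx xv sv; have [xR sR] := spoke_side sdT sx.
have := edge_spoke n_gt0 perT xv sR; have := edge_spoke n_gt0 perT xR sv.
by have := edge_lt n_gt0 perT xv; have := edge_lt n_gt0 perT xR; lia.
Qed.

(** [L] and [R] come from a choice made at each vertex separately; periodicity follows because the
    triangles they describe are unique. *)
Lemma inc_shift l x w :
  inc (spoke T) L R (x + l * n%:Z) (w + l * n%:Z) = inc (spoke T) L R x w.
Proof.
rewrite /inc (spoke_shift perT) (inj_eq (addIr _)).
have [sw|nw] := boolP (spoke T w) => /=.
  have [wR sR] := spoke_side sdT sw.
  rewrite (@spoke_R_uniq _ (R w + l * n%:Z)) ?(spoke_shift perT) //.
    by rewrite (inj_eq (addIr _)).
  by rewrite (edge_shift n_gt0 perT).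
have [Lw wR LR] := nonspoke_sides sdT nw.
have [||| _ [-> ->]] := owned_uniq n_gt0 perT sdT (x := w + l * n%:Z)
  (u := L w + l * n%:Z) (v := R w + l * n%:Z);
  rewrite ?(edge_shift n_gt0 perT) //.
by rewrite !(inj_eq (addIr _)).
Qed.

Lemma size_owners_shift l x : size (owners (x + l * n%:Z)) = size (owners x).
Proof.
rewrite /owners !filter_map !size_map; congr size; apply: eq_filter => t /=.
by rewrite -[RHS](inc_shift l); congr inc; ring.
Qed.

Lemma quiddity_owners i : quiddity n T i (size (owners i))%:Z.
Proof.
apply: (has_card_seq (f := owned_region n T L R)) => [||r].
- exact: owners_uniq.
- by move=> x y _ _; apply: owned_region_inj.
rewrite /lower /position mul0r addr0; split => [[/(triangleE n_gt0 perT sdT)[x ->]]|].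
  by rewrite incident_owned -mem_owners => xi; exists x.
move=> [x + ->]; rewrite mem_owners => ix; split; last by rewrite incident_owned.
exact: triangle_owned.
Qed.

Lemma matchings_card p q :
  has_card (matchings T p q)
    (size (matching_seqs owners p `|(q - p)%R|%N.+1))%:Z.
Proof.
pose reg := owned_region n T L R; set s := `|(q - p)%R|%N.+1.
pose phi (f : seq int) := [tuple reg (nth 0 f t) | t < s].
have phiE f : size f = s -> phi f = map reg f :> seq _.
  move=> sf; apply: (@eq_from_nth _ (reg 0)); first by rewrite size_tuple size_map.
  move=> t; rewrite size_tuple => ts.
  by rewrite (nth_mktuple _ _ (Ordinal ts)) (nth_map 0) ?sf.
have reg_inj : injective reg by apply: owned_region_inj.
apply: (has_card_seq (f := phi)); first exact: matching_seqs_uniq owners_uniq _ _.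
  move=> f g /mem_matching_seqs[sf _ _] /mem_matching_seqs[sg _ _] fg.
  by apply: (inj_map reg_inj); rewrite -!phiE // fg.
move=> tau; split=> [[ut tT ti]|[f /mem_matching_seqs[sf uf hf] ->]].
  (* Every triangle is owned, so a matching is read as the list of the owners of its triangles. *)
  have [x xE] := choice (fun t => triangleE n_gt0 perT sdT (tT t)).
  pose f := map x (enum 'I_s).
  have sf : size f = s by rewrite size_map size_enum_ord.
  have fn (t : 'I_s) : nth 0 f t = x t.
    by rewrite (nth_map t) ?size_enum_ord // nth_ord_enum.
  have tE : tau = phi f.
    by apply: eq_from_tnth => t; rewrite tnth_mktuple fn xE.
  exists f => //; apply/mem_matching_seqs; split => //.
    by move: ut; rewrite tE phiE // (map_inj_uniq reg_inj).
  move=> t ts; rewrite (fn (Ordinal ts)) mem_owners -(incident_owned n) -xE.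
  exact: ti (Ordinal ts).
split.
- by rewrite phiE // map_inj_uniq.
- by move=> t; rewrite tnth_mktuple; apply: triangle_owned.
- by move=> t; rewrite tnth_mktuple incident_owned -mem_owners; apply: hf.
Qed.

End Transfer.

Unset Implicit Arguments.

Theorem theorem4p20 (n : nat) (T : set (vertex * vertex))
    (m : int -> int -> int) :
  (1 <= n)%N ->
  periodic_triangulation n T ->
  associated_frieze n T m ->
  forall i j k : int, i <= j ->
    has_card (matchings T (position n i k) (position n j k)) (m i j).
Proof.
move=> n_gt0 perT [frm perm quid] i j k ij.
have [L [R sdT]] := sides_ex n_gt0 perT.
(* The quiddity is given only for indices in [1..n]; both sides are [n]-periodic, so [x] may be
   translated into that range. *)
have mx x : m x x = (size (owners n T L R x))%:Z.
  have hx : x = position n (x - sup n x * n%:Z) (sup n x).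
    by rewrite /position subrK.
  rewrite hx /position size_owners_shift // (frieze_periodic_shift _ perm) //.
  apply: has_card_inj (quid _ _) _; last exact: quiddity_owners.
  by have := supP x n_gt0; rewrite /superscript /position; lia.
have rec := size_matching_seqs_rec (edge_lt n_gt0 perT) (@edge_succ T)
  (edge_noncrossing n_gt0 perT) (edge_spoke n_gt0 perT) (nonspoke_sides sdT)
  (spoke_side sdT) (owners_uniq T L R n_gt0) (mem_owners n_gt0 perT sdT).
have := matchings_card n_gt0 perT sdT (position n i k) (position n j k).
(* The number of vertices is one more than the distance of the end positions, which accounts for the
   [- 1]; periodicity of [m] then removes [k]. *)
rewrite -(frieze_size frm mx rec) (_ : _ + _ - 1 = position n j k).
  by rewrite /position (frieze_periodic_shift _ perm).
by rewrite /position; lia.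
Qed.
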